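(* Let $G=(V,E)$ be a $\lambda$-expander graph, $l\ge1$, and $f:V\to\{0,1\}$ with $\mu:=\mathbb E_{v\sim U(V)} f(v)$. Let $\gamma$ be real with $\mu+\lambda\le\gamma\le 1$. Then \[ \Pr_{w\sim\mathrm{Walk}(G,l)}\Big(\textstyle\sum_{i\in[l]} f(w_i)\ge \gamma l\Big)\le \exp\big(-l\,D(\gamma\,\|\,\mu+\lambda)\big). \]
   Context: $[l]:=\{0,\dots,l-1\}$; $U(V)$ is the uniform distribution on $V$. $D(p\|q):=p\ln\frac pq+(1-p)\ln\frac{1-p}{1-q}$ is the Kullback–Leibler divergence between Bernoulli distributions (with $0\ln 0=0$ and $\exp(-\infty)=0$). Graphs are finite, undirected, may have parallel edges and self-loops; the adjacency matrix $A=(a_{uv})$ counts edges between $u$ and $v$; the graph is $d$-regular ($d\ge1$) if $A$ is symmetric with all row sums $d$; it is a $\lambda$-expander if it is $d$-regular and the second largest absolute value of the eigenvalues of $A$ (with multiplicity) is at most $d\lambda$. $\mathrm{Walk}(G,l)$ is the distribution of $w=(w_0,\dots,w_{l-1})$ where $w_0$ is uniform on $V$ and $w_{i+1}=u$ with probability $a_{w_iu}/d$ given the past. *)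

(* Defs.v *)
From HB Require Import structures.
From mathcomp Require Import all_boot all_order all_algebra.
From mathcomp Require Import all_classical all_reals all_analysis.
Set Implicit Arguments. Unset Strict Implicit. Unset Printing Implicit Defensive.
Import Order.TTheory GRing.Theory Num.Theory.
Local Open Scope ring_scope.

Section Defs.
Variable R : realType.

(* Graph on vertex set V = 'I_n given by its adjacency matrix A (entries in nat:
   number of edges between u and v). *)

Definition adjR n (A : 'M[nat]_n) : 'M[R]_n := map_mx (fun k => k%:R) A.

Definition regular n (A : 'M[nat]_n) (d : nat) : Prop :=
  A^T = A /\ (forall u : 'I_n, (\sum_(v < n) A u v)%N = d) /\ (1 <= d)%N.

Definition eigenvalues_with_mult n (M : 'M[R]_n) (s : seq R) : Prop :=
  char_poly M = \prod_(x <- s) ('X - x%:P).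

(* second largest absolute value of the eigenvalues (with multiplicity):
   the entry of index 1 of the absolute values sorted in decreasing order
   (default 0 if there is only one eigenvalue). *)
Definition second_abs (s : seq R) : R :=
  nth 0 (sort (fun x y : R => y <= x) (map (fun x => `|x|) s)) 1.

Definition expander n (A : 'M[nat]_n) (d : nat) (lam : R) : Prop :=
  regular A d /\
  exists s, eigenvalues_with_mult (adjR A) s /\ second_abs s <= d%:R * lam.

Fixpoint trans_prob n (A : 'M[nat]_n) (d : nat) (x : 'I_n) (s : seq 'I_n) : R :=
  match s with
  | [::] => 1
  | y :: s' => (A x y)%:R / d%:R * trans_prob A d y s'
  end.

Definition walk_prob n (A : 'M[nat]_n) (d : nat) (w : seq 'I_n) : R :=
  match w with
  | [::] => 1
  | x :: s => (n%:R)^-1 * trans_prob A d x s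
  end.

Definition walk_Pr n (A : 'M[nat]_n) (d l : nat) (P : pred (l.-tuple 'I_n)) : R :=
  \sum_(w : l.-tuple 'I_n | P w) walk_prob A d w.

(* p ln(p/q) with conventions 0 ln 0 = 0 (0 * anything = 0) and p ln(p/0) = +oo for p > 0 *)
Definition xlnxy (p q : R) : \bar R :=
  if p == 0 then 0%E else if q == 0 then +oo%E else (p * ln (p / q))%:E.

Definition KL (p q : R) : \bar R := (xlnxy p q + xlnxy (1 - p) (1 - q))%E.

(* exp(-x) with exp(-oo) = 0 (the -oo argument never occurs; dummy value 0) *)
Definition expN (x : \bar R) : R :=
  match x with
  | EFin r => expR (- r)
  | EPInf => 0
  | ENInf => 0
  end.

End Defs.

(* Main.v *)
Require Import Defs.
From HB Require Import structures.
From mathcomp Require Import all_boot all_order all_algebra.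
From mathcomp Require Import all_classical all_reals all_analysis.
From mathcomp Require Import spectral sesquilinear complex ring lra.
Import Order.TTheory GRing.Theory Num.Theory.
Local Open Scope ring_scope.

(** Put [delta := mu + lam] and weight a vertex [v] by the likelihood ratio [t v],
    equal to [gamma / delta] if [f v] and to [(1 - gamma) / (1 - delta)] otherwise.
    On the event in question the product of the weights along the walk is at least
    [exp (l * D(gamma || delta))], so by Markov's inequality it suffices that this
    product has expectation at most 1.  That expectation is [<1, B^(l-1) 1>_t / n],
    where [B g x = sum_y A x y / d * t y * g y] is self-adjoint for the weighted
    product [<x, y>_t = sum_v t v * x v * y v].  The spectral theorem bounds the
    quadratic form of [A / d] by
    [(1 - lam) * (sum a)^2 / n + lam * sum a^2], and with [a = t x] the
    Cauchy-Schwarz inequality bounds this by [<x, x>_t], because the weights satisfy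
    [gamma / delta * delta + (1 - gamma) / (1 - delta) * (1 - delta) = 1].  Hence [B]
    is a contraction and the expectation is at most the mean of [t], which is at
    most 1. *)

(** * Quadratic forms off a dominant eigenvector *)

Lemma char_poly_conj {F : fieldType} {n} (P M : 'M[F]_n) : P \in unitmx ->
  char_poly (invmx P *m M *m P) = char_poly M.
Proof.
move=> Pu; rewrite /char_poly /char_poly_mx !map_mxM map_invmx.
set Q := map_mx _ P.
have Qu : Q \in unitmx by rewrite map_unitmx.
have -> : 'X%:M - invmx Q *m map_mx polyC M *m Q =
          invmx Q *m ('X%:M - map_mx polyC M) *m Q.
  by rewrite mulmxBr mulmxBl scalar_mxC -(mulmxA _ (invmx Q)) mulVmx // mulmx1.
by rewrite !det_mulmx mulrAC -det_mulmx mulVmx // det1 mul1r.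
Qed.

Section HermitianForms.
Local Open Scope sesquilinear_scope.

(** In an orthonormal eigenbasis [th] occupies the only diagonal slot exceeding [c] in absolute
    value. So [e] is supported on that coordinate, [a] vanishes there, and the other eigenvalues are
    bounded by [c]. *)
Lemma normal_form_le {C : numClosedFieldType} {n} (A : 'M[C]_n) (s : seq C)
    (c th : C) (e a : 'rV[C]_n) :
  A \is normalmx ->
  char_poly A = \prod_(x <- s) ('X - x%:P) ->
  (count (fun x : C => ~~ (`|x| <= c)%R) s <= 1)%N ->
  e != 0 -> e *m A = th *: e -> ~~ (`|th| <= c) ->
  a *m e ^t* = 0 ->
  `|(a *m A *m a ^t*) 0 0| <= c * (a *m a ^t*) 0 0.
Proof.
move=> /orthomx_spectralP; set P := spectralmx A; set D := spectral_diag A.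
move=> AE pA cnt e0 eA thc ae.
have Pu : P \is unitarymx := spectral_unitarymx A.
have PV : invmx P = P ^t* by rewrite invmx_unitary.
have PVP : P ^t* *m P = 1%:M by rewrite -PV mulVmx ?unitarymx_unit.
have PPV : P *m P ^t* = 1%:M by apply/unitarymxP.
(* Unique factorisation of the characteristic polynomial matches the spectral diagonal with [s],
   multiplicities included, so [cnt] can be read as a count of indices. *)
have perm : perm_eq [seq D 0 i | i <- enum 'I_n] s.
  apply: prod_XsubC_eq; rewrite -pA AE char_poly_conj ?unitarymx_unit //.
  rewrite char_poly_trig ?diag_mx_is_trig // big_map big_enum /=.
  by apply: eq_bigr => i _; rewrite mxE eqxx mulr1n.
have ctE (u : 'rV[C]_n) i : (u ^t*) i 0 = (u 0 i)^* by rewrite !mxE.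
pose b := a *m P ^t*; pose f := e *m P ^t*.
have aE : a = b *m P by rewrite /b -mulmxA PVP mulmx1.
have eE : e = f *m P by rewrite /f -mulmxA PVP mulmx1.
have fD i : f 0 i * D 0 i = th * f 0 i.
  have /rowP/(_ i) : f *m diag_mx D = th *: f.
    by rewrite {2}/f scalemxAl -eA AE PV eE !mulmxA -!(mulmxA _ P) PPV !mulmx1.
  by rewrite mul_mx_diag !mxE.
have [i0 fi0] : exists i, f 0 i != 0.
  case: (pickP (fun i => f 0 i != 0)) => [i fi|fN]; first by exists i.
  have f0 : f = 0 by apply/rowP => i; rewrite [RHS]mxE; apply/eqP/negPn; rewrite fN.
  by move: e0; rewrite eE f0 mul0mx eqxx.
have fth i : f 0 i != 0 -> D 0 i = th.
  by move=> fi; apply: (mulfI fi); rewrite fD mulrC.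
have Dle i : i != i0 -> `|D 0 i| <= c.
  move=> ii0; apply/negPn/negP => Dc; move: cnt; rewrite -(permP perm) count_map.
  rewrite -size_filter => cnt.
  have : (2 <= size [seq x <- enum 'I_n | ~~ (`|D 0 x| <= c)%R])%N.
    have -> : 2%N = size [:: i; i0] by [].
    apply: uniq_leq_size => /=; first by rewrite inE ii0.
    move=> j; rewrite !inE mem_filter mem_enum andbT => /orP[]/eqP-> //.
    by rewrite fth.
  by move=> /leq_trans/(_ cnt).
have f0 i : i != i0 -> f 0 i = 0.
  move=> ii0; apply: contraNeq thc => /fth <-; exact: Dle.
have b0 : b 0 i0 = 0.
  have : (b *m f ^t*) 0 0 = 0.
    rewrite /b /f -mulmxA trmx_mul map_mxM trmxCK (mulmxA _ P) PVP mul1mx.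
    by rewrite ae mxE.
  rewrite mxE (bigD1 i0) //= big1 => [|i ii0]; last first.
    by rewrite ctE f0 // conjC0 mulr0.
  rewrite addr0 ctE => /eqP; rewrite mulf_eq0 conjC_eq0 (negPf fi0) orbF.
  by move/eqP.
have aa : (a *m a ^t*) 0 0 = \sum_i `|b 0 i| ^+ 2.
  rewrite aE trmx_mul map_mxM /= mulmxA -(mulmxA b) PPV mulmx1 mxE.
  by apply: eq_bigr => i _; rewrite ctE normCK.
have aAa : (a *m A *m a ^t*) 0 0 = \sum_i D 0 i * `|b 0 i| ^+ 2.
  rewrite aE AE PV trmx_mul map_mxM /= !mulmxA -(mulmxA b P) PPV mulmx1.
  rewrite -(mulmxA _ P) PPV mulmx1 mul_mx_diag mxE.
  by apply: eq_bigr => i _; rewrite ctE mxE normCK mulrAC mulrC.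
rewrite aa aAa mulr_sumr; apply: le_trans (ler_norm_sum _ _ _) _.
apply: ler_sum => i _; rewrite normrM [`|_ ^+ 2|]ger0_norm ?exprn_ge0 //.
have [->|ii0] := eqVneq i i0; first by rewrite b0 normr0 expr0n !mulr0.
by rewrite ler_wpM2r ?exprn_ge0 // Dle.
Qed.

(** Over the complex numbers a real symmetric matrix is Hermitian, hence normal, and the embedding
    preserves norms and order. *)
Lemma symmetric_form_le {R : rcfType} {n} (A : 'M[R]_n) (s : seq R) (c th : R)
    (e a : 'rV[R]_n) :
  A^T = A ->
  char_poly A = \prod_(x <- s) ('X - x%:P) ->
  (count (fun x : R => ~~ (`|x| <= c)%R) s <= 1)%N ->
  e != 0 -> e *m A = th *: e -> ~~ (`|th| <= c) ->
  a *m e^T = 0 ->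
  `|(a *m A *m a^T) 0 0| <= c * (a *m a^T) 0 0.
Proof.
move=> AT pA cnt e0 eA thc ae.
pose h := real_complex R.
have hnorm x : `|h x| = h `|x| by rewrite normc_def /= expr0n addr0 sqrtr_sqr.
have hmx m k (M : 'M[R]_(m, k)) : (map_mx h M) ^t* = map_mx h M^T.
  by apply/matrixP => i j; rewrite !mxE; apply: conjc_real.
have := @normal_form_le _ _ (map_mx h A) (map h s) (h c) (h th) (map_mx h e)
  (map_mx h a).
have hE (M : 'M[R]_1) : map_mx h M 0 0 = h (M 0 0) by rewrite mxE.
rewrite !hmx -!map_mxM !hE -rmorphM !hnorm !lecR; apply.
- by apply/normalmxP; rewrite hmx AT.
- rewrite -map_char_poly pA rmorph_prod big_map /=.
  by apply: eq_bigr => x _; rewrite rmorphB /= map_polyX map_polyC.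
- rewrite count_map; apply: leq_trans cnt; rewrite leq_eqVlt; apply/orP; left.
  by apply/eqP; apply: eq_count => x /=; rewrite hnorm lecR.
- by rewrite map_mx_eq0.
- by rewrite eA map_mxZ.
- exact: thc.
- by rewrite ae map_mx0.
Qed.

End HermitianForms.

(** * Quadratic form of an expander *)

Lemma count_second_abs {R : realType} (s : seq R) (c : R) :
  second_abs s <= c -> (count (fun x : R => ~~ (`|x| <= c)%R) s <= 1)%N.
Proof.
rewrite /second_abs; set t := sort _ _ => tc.
have -> : count (fun x : R => ~~ (`|x| <= c)) s = count (fun y => ~~ (y <= c)) t.
  by rewrite count_sort count_map.
have: sorted (fun x y : R => y <= x) t by apply: sort_sorted => x y; exact: le_total.
(* Only the head of the decreasing list may exceed [c], since the entry at index 1 bounds all later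
   ones. With fewer than two entries the count is trivially at most 1. *)
case: t tc => [|y [|z t]] //= zc; first by case: (y <= c).
move=> /andP[_]; rewrite path_sortedE; last by move=> ? ? ? /[swap]; exact: le_trans.
move=> /andP[/allP zt _]; rewrite zc add0n.
suff -> : count (fun y => ~~ (y <= c)) t = 0%N by rewrite addn0; case: (_ <= c).
rewrite (@eq_in_count _ _ pred0) ?count_pred0 // => x /zt xz /=.
by rewrite (le_trans xz).
Qed.

Lemma second_abs_ge0 {R : realType} (s : seq R) : 0 <= second_abs s.
Proof.
rewrite /second_abs; set t := sort _ _.
have [lt1|] := ltnP 1 (size t); last by move=> ?; rewrite nth_default.
have := mem_nth 0 lt1; rewrite mem_sort => /mapP[x _ ->]; exact: normr_ge0.
Qed.

(** The all-ones vector is an eigenvector for [d], [lam < 1] puts [d] above the threshold [d * lam],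
    and zero sum means orthogonality to that vector. *)
Lemma expander_form_orth {R : realType} {n} (A : 'M[nat]_n) (d : nat) (lam : R)
    (a : 'I_n -> R) :
  (0 < n)%N -> expander A d lam -> lam < 1 -> \sum_v a v = 0 ->
  `|\sum_u \sum_v a u * (A u v)%:R * a v| <= d%:R * lam * \sum_v a v ^+ 2.
Proof.
move=> n0 [[AT [rs d1]] [s [sE sl]]] lam1 a0.
pose av : 'rV[R]_n := \row_v a v.
have := @symmetric_form_le R n (adjR R A) s (d%:R * lam) d%:R (const_mx 1) av.
have -> : (av *m av^T) 0 0 = \sum_v a v ^+ 2.
  by rewrite mxE; apply: eq_bigr => i _; rewrite !mxE expr2.
have -> : (av *m adjR R A *m av^T) 0 0 = \sum_u \sum_v a u * (A u v)%:R * a v.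
  rewrite exchange_big mxE; apply: eq_bigr => i _; rewrite !mxE mulr_suml.
  by apply: eq_bigr => j _; rewrite !mxE.
apply.
- by rewrite /adjR map_trmx AT.
- exact: sE.
- exact: count_second_abs.
- by apply/eqP => /rowP/(_ (Ordinal n0)) /eqP; rewrite !mxE oner_eq0.
- apply/rowP => j; rewrite !mxE mulr1 -(rs j) natr_sum.
  by apply: eq_bigr => i _; rewrite !mxE mul1r -[in LHS]AT mxE.
- by rewrite normr_nat -ltNge -[ltRHS]mulr1 ltr_pM2l // ltr0n.
- apply/matrixP => i j; rewrite !mxE -[RHS]a0.
  by apply: eq_bigr => k _; rewrite !mxE mulr1.
Qed.

(** Subtracting the mean [m] leaves a zero-sum [b]. The cross terms vanish because rows and columns
    of [A] sum to [d], and the constant part contributes [d * m ^+ 2 * n]. *)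
Lemma expander_form {R : realType} {n} (A : 'M[nat]_n) (d : nat) (lam : R)
    (a : 'I_n -> R) :
  (0 < n)%N -> expander A d lam -> lam < 1 ->
  `|\sum_u \sum_v a u * (A u v)%:R * a v| <=
    d%:R * ((1 - lam) * ((\sum_v a v) ^+ 2 / n%:R) + lam * \sum_v a v ^+ 2).
Proof.
move=> n0 eA lam1; have [[AT [rs d1]] _] := eA.
have n0R : n%:R != 0 :> R by rewrite pnatr_eq0 -lt0n.
pose m := (\sum_v a v) / n%:R; pose b v := a v - m.
have b0 : \sum_v b v = 0.
  rewrite big_split /= sumr_const card_ord -[- m *+ n]mulr_natr mulNr.
  by rewrite /m mulfVK ?subrr.
have sumA := mulfVK n0R (\sum_v a v); rewrite -/m in sumA.
have bA := @expander_form_orth R n A d lam b n0 eA lam1 b0.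
have b2 : \sum_v a v ^+ 2 = \sum_v b v ^+ 2 + m ^+ 2 * n%:R.
  transitivity (\sum_v (b v ^+ 2 + 2 * m * b v + m ^+ 2)).
    by apply: eq_bigr => v _; rewrite /b; ring.
  by rewrite !big_split /= -mulr_sumr b0 sumr_const card_ord mulr0 addr0 mulr_natr.
have rsR u : \sum_v (A u v)%:R = d%:R :> R by rewrite -natr_sum rs.
have AC u v : A u v = A v u by rewrite -[in LHS]AT mxE.
have csR v : \sum_u (A u v)%:R = d%:R :> R.
  by rewrite -(rsR v); apply: eq_bigr => u _; rewrite AC.
have aE : \sum_u \sum_v a u * (A u v)%:R * a v =
    \sum_u \sum_v b u * (A u v)%:R * b v + d%:R * m ^+ 2 * n%:R.
  transitivity (\sum_u \sum_v b u * (A u v)%:R * b v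
     + (\sum_u \sum_v b u * (A u v)%:R * m + \sum_u \sum_v m * (A u v)%:R * b v)
     + \sum_u \sum_v m ^+ 2 * (A u v)%:R).
    rewrite -!big_split /=; apply: eq_bigr => u _; rewrite -!big_split /=.
    by apply: eq_bigr => v _; rewrite /b; ring.
  have -> : \sum_u \sum_v b u * (A u v)%:R * m = 0.
    transitivity (\sum_u b u * (d%:R * m)); last by rewrite -mulr_suml b0 mul0r.
    by apply: eq_bigr => u _; rewrite -mulr_suml -mulr_sumr rsR mulrA.
  have -> : \sum_u \sum_v m * (A u v)%:R * b v = 0.
    rewrite exchange_big /=.
    transitivity (\sum_v (m * d%:R) * b v); last by rewrite -mulr_sumr b0 mulr0.
    by apply: eq_bigr => v _; rewrite -mulr_suml -mulr_sumr csR.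
  have -> : \sum_u \sum_v m ^+ 2 * (A u v)%:R = d%:R * m ^+ 2 * n%:R.
    under eq_bigr => u _ do rewrite -mulr_sumr rsR.
    by rewrite sumr_const card_ord -[_ *+ n]mulr_natr (mulrC d%:R).
  by rewrite !addr0.
have -> : (\sum_v a v) ^+ 2 / n%:R = m ^+ 2 * n%:R.
  by rewrite -sumA; field.
rewrite aE b2; apply: le_trans (ler_normD _ _) _.
rewrite [X in _ + X]ger0_norm; last by apply: mulr_ge0 => //; apply: mulr_ge0 => //; exact: sqr_ge0.
apply: le_trans (lerD bA (lexx _)) _; rewrite le_eqVlt; apply/orP; left.
by apply/eqP; ring.
Qed.

(** * The weighted walk operator *)

Definition wdot {R : realType} {n} (t x y : 'I_n -> R) : R :=
  \sum_v t v * x v * y v.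

Definition wstep {R : realType} {n} (A : 'M[nat]_n) (d : nat)
    (t g : 'I_n -> R) (x : 'I_n) : R :=
  \sum_y (A x y)%:R / d%:R * (t y * g y).

(** Lagrange's identity: twice the gap between the two sides is a double sum of weighted squares. *)
Lemma weighted_cauchy_schwarz {R : realDomainType} {n} (t x : 'I_n -> R) :
  (forall v, 0 <= t v) ->
  (\sum_v t v * x v) ^+ 2 <= (\sum_v t v) * \sum_v t v * x v ^+ 2.
Proof.
move=> t0.
have : 0 <= \sum_u \sum_v t u * t v * (x u - x v) ^+ 2.
  by apply: sumr_ge0 => u _; apply: sumr_ge0 => v _; apply: mulr_ge0 (sqr_ge0 _); apply: mulr_ge0.
have -> : \sum_u \sum_v t u * t v * (x u - x v) ^+ 2 =
  2 * ((\sum_v t v) * (\sum_v t v * x v ^+ 2) - (\sum_v t v * x v) ^+ 2).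
  transitivity (\sum_u \sum_v (t u * x u ^+ 2) * t v
     + \sum_u \sum_v t u * (t v * x v ^+ 2)
     - 2 * \sum_u \sum_v (t u * x u) * (t v * x v)).
    rewrite mulr_sumr -sumrN -!big_split /=; apply: eq_bigr => u _.
    rewrite mulr_sumr -sumrN -!big_split /=; apply: eq_bigr => v _; ring.
  by rewrite -!big_distrlr /=; ring.
by rewrite pmulr_rge0 ?ltr0n // subr_ge0.
Qed.

Section WeightedStep.
Variables (R : realType) (n : nat) (A : 'M[nat]_n) (d : nat) (lam p : R).
Variable t : 'I_n -> R.
Hypotheses (n0 : (0 < n)%N) (eA : expander A d lam).
Hypotheses (lam0 : 0 <= lam) (lam1 : lam < 1).
Hypotheses (t0 : forall v, 0 <= t v) (tp : forall v, t v <= p).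
Hypothesis tle1 : (1 - lam) * ((\sum_v t v) / n%:R) + lam * p <= 1.

Local Notation B := (wstep A d t).

Lemma wdot_ge0 x : 0 <= wdot t x x.
Proof. by apply: sumr_ge0 => v _; rewrite -mulrA mulr_ge0 // -expr2 sqr_ge0. Qed.

Lemma wdot_wstepE x y : wdot t x (B y) =
  d%:R^-1 * \sum_u \sum_v (t u * x u) * (A u v)%:R * (t v * y v).
Proof.
rewrite mulr_sumr; apply: eq_bigr => u _; rewrite !mulr_sumr.
by apply: eq_bigr => v _; ring.
Qed.

Lemma wdot_wstepC x y : wdot t x (B y) = wdot t y (B x).
Proof.
rewrite !wdot_wstepE exchange_big /=; congr (_ * _).
apply: eq_bigr => u _; apply: eq_bigr => v _.
have [[AT _] _] := eA.
by have -> : A v u = A u v by [rewrite -[in LHS]AT mxE]; ring.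
Qed.

(** In [expander_form] for [t v * x v], Cauchy-Schwarz turns the squared sum into [\sum_v t v] times
    [wdot t x x], and [t v <= p] turns the sum of squares into [p] times it. The total coefficient
    is the left side of [tle1]. *)
Lemma wdot_wstep_le x : `|wdot t x (B x)| <= wdot t x x.
Proof.
have [[_ [_ d1]] _] := eA.
have d0 : 0 < d%:R :> R by rewrite ltr0n.
rewrite wdot_wstepE normrM ger0_norm ?invr_ge0 ?ler0n // mulrC.
rewrite ler_pdivrMr // mulrC.
apply: le_trans (@expander_form R n A d lam (fun v => t v * x v) n0 eA lam1) _.
rewrite ler_pM2l //.
have nV : 0 <= n%:R^-1 :> R by rewrite invr_ge0.
have xx : wdot t x x = \sum_v t v * x v ^+ 2.
  by apply: eq_bigr => v _; rewrite expr2 mulrA.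
have sq : \sum_v (t v * x v) ^+ 2 <= p * wdot t x x.
  rewrite xx mulr_sumr; apply: ler_sum => v _.
  have -> : (t v * x v) ^+ 2 = t v * (t v * x v ^+ 2) by ring.
  by rewrite ler_wpM2r // mulr_ge0 // sqr_ge0.
have cs := @weighted_cauchy_schwarz R n t x t0; rewrite -xx in cs.
apply: (@le_trans _ _ ((1 - lam) * ((\sum_v t v) * wdot t x x / n%:R)
                      + lam * (p * wdot t x x))).
  by apply: lerD; apply: ler_wpM2l => //; [rewrite subr_ge0 ltW | apply: ler_wpM2r].
have -> : (1 - lam) * ((\sum_v t v) * wdot t x x / n%:R) + lam * (p * wdot t x x)
  = ((1 - lam) * ((\sum_v t v) / n%:R) + lam * p) * wdot t x x by ring.
by rewrite -[leRHS]mul1r ler_wpM2r // wdot_ge0.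
Qed.

(* [B] is self-adjoint for [wdot t], so its bilinear form is recovered from the
   quadratic form at [x + y] and [x - y]. *)
Lemma wdot_wstep_polar x y :
  wdot t x (B y) <= (wdot t x x + wdot t y y) / 2.
Proof.
have E s : wdot t (fun v => x v + s * y v) (B (fun v => x v + s * y v)) =
  wdot t x (B x) + 2 * s * wdot t x (B y) + s ^+ 2 * wdot t y (B y).
  have -> : 2 * s * wdot t x (B y) = s * wdot t x (B y) + s * wdot t y (B x).
    by rewrite (wdot_wstepC y); ring.
  rewrite !wdot_wstepE !mulr_sumr -!big_split /=; apply: eq_bigr => u _.
  rewrite !mulr_sumr -!big_split /=; apply: eq_bigr => v _; ring.
have N s : wdot t (fun v => x v + s * y v) (fun v => x v + s * y v) =
  wdot t x x + 2 * s * wdot t x y + s ^+ 2 * wdot t y y.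
  by rewrite /wdot !mulr_sumr -!big_split /=; apply: eq_bigr => u _; ring.
(* The forms at [s = 1] and [s = -1] differ by [4 * wdot t x (B y)], while the squared norms add up
   to twice [wdot t x x + wdot t y y]. The absolute value in [wdot_wstep_le] supplies both signs. *)
have := wdot_wstep_le (fun v => x v + 1 * y v).
have := wdot_wstep_le (fun v => x v + (-1) * y v).
rewrite !E !N !ler_norml; lra.
Qed.

(** With [x = B y] in the polarised bound, half of the left side is absorbed. *)
Lemma wstep_contract y : wdot t (B y) (B y) <= wdot t y y.
Proof. by have := wdot_wstep_polar (B y) y; lra. Qed.

Lemma wdot_iter_wstep_le k :
  wdot t (fun=> 1) (iter k B (fun=> 1)) <= \sum_v t v.
Proof.
have S : \sum_v t v = wdot t (fun=> 1) (fun=> 1).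
  by apply: eq_bigr => v _; rewrite !mulr1.
have I j : wdot t (iter j B (fun=> 1)) (iter j B (fun=> 1)) <= \sum_v t v.
  by elim: j => [|j IH] /=; rewrite ?S // -S (le_trans (wstep_contract _)).
(* One [B] is kept for the polarised bound against the constant 1, and the other [k.-1] are absorbed
   by contraction. *)
have := I k.-1; case: k => [|k] /= Ik; first by rewrite -S.
by have := wdot_wstep_polar (fun=> 1) (iter k B (fun=> 1)); rewrite -S; lra.
Qed.

End WeightedStep.

(** * Expectations along the walk *)

Lemma sum_tuple_cons {V : nmodType} {T : finType} (k : nat) (F : k.+1.-tuple T -> V) :
  \sum_w F w = \sum_x \sum_(w : k.-tuple T) F [tuple of x :: w].
Proof.
rewrite pair_big /=.
rewrite (reindex (fun p : T * k.-tuple T => [tuple of p.1 :: p.2])) //=.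
exists (fun w : k.+1.-tuple T => (thead w, [tuple of behead w])) => [[x w] _|w _] /=.
  by congr (_, _); apply: val_inj.
by rewrite [RHS]tuple_eta.
Qed.

Section Walk.
Variables (R : realType) (n : nat) (A : 'M[nat]_n) (d : nat).

Lemma trans_prob_ge0 x s : 0 <= trans_prob R A d x s.
Proof. by elim: s x => //= y s IH x; rewrite !mulr_ge0 ?invr_ge0. Qed.

Lemma walk_prob_ge0 s : 0 <= walk_prob R A d s.
Proof. by case: s => //= x s; rewrite mulr_ge0 ?invr_ge0 ?trans_prob_ge0. Qed.

Lemma sum_trans_prob (t : 'I_n -> R) k x :
  \sum_(w : k.-tuple 'I_n) trans_prob R A d x w * \prod_(y <- w) t y =
  iter k (wstep A d t) (fun=> 1) x.
Proof.
elim: k x => [|k IH] x /=.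
  rewrite (eq_bigr (fun=> 1)); last by move=> w _; rewrite tuple0 /= big_nil mulr1.
  by rewrite sumr_const card_tuple expn0.
rewrite sum_tuple_cons /wstep; apply: eq_bigr => y _; rewrite -IH !mulr_sumr.
by apply: eq_bigr => w _; rewrite /= big_cons; ring.
Qed.

(** The weight of the starting vertex sits in [wdot], so [k.+1] vertices need only [k] applications
    of the operator. *)
Lemma sum_walk_prob (t : 'I_n -> R) k :
  \sum_(w : k.+1.-tuple 'I_n) walk_prob R A d w * \prod_(y <- w) t y =
  n%:R^-1 * wdot t (fun=> 1) (iter k (wstep A d t) (fun=> 1)).
Proof.
rewrite sum_tuple_cons mulr_sumr; apply: eq_bigr => x _.
rewrite -sum_trans_prob !mulr_sumr.
by apply: eq_bigr => w _; rewrite /= big_cons; ring.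
Qed.

End Walk.

(** * Likelihood ratios and divergence *)

Lemma sum_tnth_count {R : nzRingType} {T : finType} (l : nat) (f : T -> bool)
    (w : l.-tuple T) :
  \sum_(i < l) (f (tnth w i))%:R = (count f w)%:R :> R.
Proof.
rewrite -natr_sum -(big_tuple _ _ w predT (fun v => nat_of_bool (f v))) -sum1_count.
by congr (_%:R); rewrite [RHS]big_mkcond.
Qed.

Lemma prod_two_weights {R : comNzRingType} {T : Type} (f : T -> bool) (p q : R) (s : seq T) :
  \prod_(y <- s) (if f y then p else q) =
  p ^+ count f s * q ^+ (size s - count f s).
Proof.
elim: s => [|y s IH]; first by rewrite big_nil mul1r.
have cs := count_size f s.
rewrite big_cons IH /=; case: (f y); rewrite ?add1n ?add0n ?subSS ?exprS ?mulrA //.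
by rewrite subSn // exprS mulrCA !mulrA.
Qed.

(** The endpoints 0 and 1 are covered too: [xlnxy] tests its first argument first, so the infinite
    branch is never reached. *)
Lemma KL_id {R : realType} (p : R) : KL p p = 0%E.
Proof.
rewrite /KL /xlnxy.
have E (x : R) : (if x == 0 then 0%E else if x == 0 then +oo%E
                  else (x * ln (x / x))%:E) = 0%E :> \bar R.
  by have [//|x0] := eqVneq x 0; rewrite divff // ln1 mulr0.
by rewrite !E adde0.
Qed.

(* The weights [gamma / delta] and [(1 - gamma) / (1 - delta)] are the likelihood
   ratios of Bernoulli(gamma) to Bernoulli(delta). *)
Lemma likelihood_ratio_ge {R : realType} (gamma delta : R) (k l : nat) :
  0 < delta -> delta < 1 -> delta <= gamma -> gamma <= 1 -> (k <= l)%N ->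
  gamma * l%:R <= k%:R ->
  1 <= (gamma / delta) ^+ k * ((1 - gamma) / (1 - delta)) ^+ (l - k)
       * expN (l%:R%:E * KL gamma delta)%E.
Proof.
move=> d0 d1 dg g1 kl gk.
have g0 : 0 < gamma := lt_le_trans d0 dg.
set p := gamma / delta; set q := (1 - gamma) / (1 - delta).
have p1 : 1 <= p by rewrite ler_pdivlMr // mul1r.
have p0 : 0 < p by apply: lt_le_trans p1.
rewrite /KL /xlnxy (gt_eqF g0) (gt_eqF d0) -/p -/q [1 - delta == 0]gt_eqF ?subr_gt0 //.
(* If [gamma = 1] then [q = 0] has no usable logarithm, but [k = l] is forced and [q] occurs with
   exponent 0. *)
have [ge|gn1] := eqVneq (1 - gamma) 0.
  have kE : k = l.
    apply/eqP; rewrite eqn_leq kl -(ler_nat R); move: gk.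
    by have -> : gamma = 1 by [lra]; rewrite mul1r.
  rewrite kE subnn expr0 mulr1 adde0 -EFinM /=.
  have -> : gamma = 1 by lra.
  by rewrite mul1r expRN expRM_natl lnK ?posrE // divff // expf_neq0 // gt_eqF.
have g1' : gamma < 1 by rewrite lt_neqAle g1 andbT; apply: contra gn1 => /eqP ->; rewrite subrr.
have q0 : 0 < q by rewrite divr_gt0 ?subr_gt0.
have q1 : q <= 1 by rewrite ler_pdivrMr ?subr_gt0 // mul1r lerD2l lerN2.
rewrite -EFinD -EFinM /= -{1}[p]lnK ?posrE // -{1}[q]lnK ?posrE //.
rewrite -!expRM_natl -!expRD -[leLHS]expR0 ler_expR natrB //.
(* The exponent to be shown nonnegative equals [(k - gamma * l) * (ln p - ln q)]. *)
have lp : 0 <= ln p by rewrite ln_ge0.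
have lq : ln q <= 0 by rewrite ln_le0.
nra.
Qed.

(** * The tail bound *)

Lemma walk_Pr_le1 {R : realType} {n} (A : 'M[nat]_n) (d l : nat)
    (P : pred (l.+1.-tuple 'I_n)) :
  (0 < n)%N -> regular A d -> @walk_Pr R n A d l.+1 P <= 1.
Proof.
move=> n0 [_ [rs d1]].
have <- : \sum_(w : l.+1.-tuple 'I_n) walk_prob R A d w = 1.
  (* With unit weights the expectation is the total mass, and row sums [d] make the constant 1 a
     fixed point of the operator. *)
  transitivity (\sum_(w : l.+1.-tuple 'I_n)
      walk_prob R A d w * \prod_(y <- w) (fun=> 1 : R) y).
    by apply: eq_bigr => w _; rewrite big1 ?mulr1.
  have step1 : wstep A d (fun=> 1) (fun=> 1) = (fun=> 1) :> ('I_n -> R).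
    apply/funext => x; rewrite /wstep -mulr_suml -mulr_suml -natr_sum rs.
    by rewrite !mulr1 divff // pnatr_eq0 -lt0n.
  have it k : iter k (wstep A d (fun=> 1)) (fun=> 1) = (fun=> 1) :> ('I_n -> R).
    by elim: k => //= k ->.
  rewrite (@sum_walk_prob R n A d (fun=> 1)) it /wdot; under eq_bigr do rewrite !mulr1.
  by rewrite sumr_const card_ord mulVf // pnatr_eq0 -lt0n.
rewrite /walk_Pr [leRHS](bigID P) /= lerDl.
by apply: sumr_ge0 => w _; exact: walk_prob_ge0.
Qed.

Theorem theorem3 (R : realType) (n : nat) (A : 'M[nat]_n) (d : nat) (lam : R)
  (l : nat) (f : 'I_n -> bool) (gamma : R) :
  (0 < n)%N ->
  expander A d lam ->
  (1 <= l)%N ->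
  let mu : R := (\sum_(v < n) (f v)%:R) / n%:R in
  mu + lam <= gamma -> gamma <= 1 ->
  @walk_Pr R n A d l (fun w : l.-tuple 'I_n => gamma * l%:R <= \sum_(i < l) (f (tnth w i))%:R)
  <= expN (l%:R%:E * KL gamma (mu + lam))%E.
Proof.
move=> n0 eA l1 mu; set delta := mu + lam => dg g1.
case: l l1 => // l _.
have [rA [s [_ sl]]] := eA.
have n0R : 0 < n%:R :> R by rewrite ltr0n.
have d0R : 0 < d%:R :> R by case: rA => _ [_ ?]; rewrite ltr0n.
(* The default 0 in [second_abs] makes this hold for a single vertex as well. *)
have lam0 : 0 <= lam by rewrite -(pmulr_rge0 _ d0R) (le_trans (second_abs_ge0 s)).
have mu0 : 0 <= mu by rewrite divr_ge0 // sumr_ge0.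
(* Here the divergence is 0 and the bound is 1. This settles [delta >= 1], where
   [gamma = delta = 1], and the case where [delta] and [gamma] are both at most 0. *)
have Pr1 : gamma = delta -> walk_Pr R A d (fun w : l.+1.-tuple 'I_n =>
    gamma * l.+1%:R <= \sum_(i < l.+1) (f (tnth w i))%:R) <=
    expN (l.+1%:R%:E * KL gamma delta)%E.
  by move=> ->; rewrite KL_id mule0 /= oppr0 expR0 walk_Pr_le1.
have [d1|d1] := leP 1 delta; first by apply: Pr1; apply/eqP; rewrite eq_le (le_trans g1).
have [d0|d0] := leP delta 0.
  have [g0|g0] := leP gamma 0; first by apply: Pr1; rewrite /delta in d0 dg *; lra.
  (* Now [mu = lam = 0] and [gamma > 0], so [f] vanishes everywhere and the event is empty. *)
  have muE : mu = 0 by rewrite /delta in d0; lra.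
  have f0 v : (f v)%:R = 0 :> R.
    have S0 : \sum_(v < n) (f v)%:R = 0 :> R.
      by move/eqP: muE; rewrite mulf_eq0 invr_eq0 (gt_eqF n0R) orbF => /eqP.
    by have /psumr_eq0P -> := S0.
  rewrite /walk_Pr big_pred0 => [|w].
    by case: (_ * _)%E => //= r; exact: expR_ge0.
  by rewrite big1 // leNgt mulr_gt0.
have lam1 : lam < 1 by rewrite /delta in d1; lra.
have g0 : 0 < gamma := lt_le_trans d0 dg.
set p := gamma / delta; set q := (1 - gamma) / (1 - delta).
pose t v : R := if f v then p else q.
have p1 : 1 <= p by rewrite ler_pdivlMr // mul1r.
have q0 : 0 <= q by rewrite divr_ge0 ?subr_ge0 // ltW.
have q1 : q <= 1 by rewrite ler_pdivrMr ?subr_gt0 // mul1r lerD2l lerN2.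
have pq : p * delta + q * (1 - delta) = 1.
  by rewrite /p /q !mulfVK ?subr_eq0 ?gt_eqF //; ring.
have st : (\sum_v t v) / n%:R = p * mu + q * (1 - mu).
  have -> : \sum_v t v = p * (\sum_(v < n) (f v)%:R) + q * (n%:R - \sum_(v < n) (f v)%:R).
    have -> : n%:R = \sum_(v < n) (1 : R) by rewrite sumr_const card_ord.
    rewrite -sumrB !mulr_sumr -big_split; apply: eq_bigr => v _; rewrite /t /=.
    by case: (f v) => /=; ring.
  by rewrite /mu; field; rewrite gt_eqF.
(* By [pq] these are exact gaps: the first is 1 minus the mean of [t], the second 1 minus the left
   side of [tle1]. *)
have lpq : 0 <= lam * (p - q) by apply: mulr_ge0 => //; lra.
have lmpq : 0 <= mu * (lam * (p - q)) by exact: mulr_ge0.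
have Epi : \sum_(w : l.+1.-tuple 'I_n) walk_prob R A d w * \prod_(y <- w) t y <= 1.
  rewrite sum_walk_prob mulrC ler_pdivrMr // mul1r.
  apply: (@le_trans _ _ (\sum_v t v)); last first.
    rewrite -[leRHS]mul1r -ler_pdivrMr // st -[leRHS]pq /delta -subr_ge0.
    by apply: le_trans lpq _; rewrite le_eqVlt; apply/orP; left; apply/eqP; ring.
  apply: (@wdot_iter_wstep_le _ _ _ _ lam p) => //.
  - by move=> v; rewrite /t; case: (f v) => //; lra.
  - by move=> v; rewrite /t; case: (f v) => //; lra.
  - rewrite st -[leRHS]pq /delta -subr_ge0.
    by apply: le_trans lmpq _; rewrite le_eqVlt; apply/orP; left; apply/eqP; ring.
set K := expN _.
have K0 : 0 <= K.
  by rewrite /K; case: (_ * _)%E => //= r; exact: expR_ge0.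
have wp w : 0 <= walk_prob R A d w * \prod_(y <- w) t y.
  rewrite mulr_ge0 ?walk_prob_ge0 //; elim/big_ind: _ => // [x y|v _]; first exact: mulr_ge0.
  by rewrite /t; case: (f v) => //; lra.
(* Markov's inequality: terms off the event are nonnegative and dropped, and on it [K] times the
   product of weights is at least 1. *)
apply: (@le_trans _ _ (K * \sum_(w : l.+1.-tuple 'I_n)
    walk_prob R A d w * \prod_(y <- w) t y)); last by rewrite ler_piMr.
rewrite mulr_sumr [leRHS](bigID (fun w : l.+1.-tuple 'I_n =>
    gamma * l.+1%:R <= \sum_(i < l.+1) (f (tnth w i))%:R)) /=.
apply: ler_wpDr; first by apply: sumr_ge0 => w _; rewrite mulr_ge0.
apply: ler_sum => w; rewrite sum_tnth_count => ev.
rewrite mulrCA -[leLHS]mulr1 ler_wpM2l ?walk_prob_ge0 // mulrC /t prod_two_weights size_tuple.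
apply: likelihood_ratio_ge => //.
by rewrite -{2}(size_tuple w) count_size.
Qed.
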